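(* Let $n,m\ge1$ and $\mathcal X\subseteq\mathbb Z^p\times\mathbb R^{n-p}$ with $0\le p\le n$. Assume that for all $i\in[m]$: (i) $\mathcal U_i=[\overline u_i,\overline u_i+\Delta u_i]\subseteq\mathbb R_{>0}$ is a one-dimensional interval with $\Delta u_i>0$; (ii) there is a function $l_i:\mathcal X\to\{0,1\}$ such that $f_i(x,u_i)=u_il_i(x)$ for all $u_i\in\mathcal U_i$ and $x\in\mathcal X$. Let $\Gamma\in[m]$ and $\Delta u_0:=0$. Then the $\Gamma$-counterpart $$\inf_{x\in\mathcal X}\ \sup_{\mathcal S\subseteq[m]:|\mathcal S|\le\Gamma}\Big\{\sum_{i\in\mathcal S}\sup_{u_i\in\mathcal U_i}f_i(x,u_i)+\sum_{i\in[m]\setminus\mathcal S}f_i(x,\overline u_i)\Big\}$$ is equivalent to $$\inf_{k\in[m]_0}\Big\{\Gamma\Delta u_k+\inf_{x\in\mathcal X}\Big\{\overline u^Tl(x)+\sum_{j\in[m]}\max\{0,\Delta u_j-\Delta u_k\}\,l_j(x)\Big\}\Big\}.$$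
   Context: Notation: $[m]:=\{1,\dots,m\}$, $[m]_0:=\{0,1,\dots,m\}$, $\overline u=(\overline u_i)_{i\in[m]}$, $l(x)=(l_i(x))_{i\in[m]}$. Two minimization programs in $x$ (possibly with further auxiliary variables or indices) are called equivalent if they have the same optimal value in $[-\infty,\infty]$ and, whenever this value is finite, a point $x\in\mathcal X$ attains it in one program (for a suitable choice of the auxiliary variables or indices) if and only if it does so in the other. *)

(* Defs.v *)
From HB Require Import structures.
From mathcomp Require Import all_boot all_order all_algebra.
From mathcomp Require Import all_classical all_reals all_analysis.
Set Implicit Arguments.
Unset Strict Implicit.
Unset Printing Implicit Defensive.
Import Order.TTheory GRing.Theory Num.Theory.
Local Open Scope classical_set_scope.
Local Open Scope ring_scope.

(* Z^p x R^(n-p): the first p coordinates are integers. *)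
Definition mixed_integer_space (R : realType) (p n : nat) : set 'rV[R]_n :=
  [set x | forall j : 'I_n, (j < p)%N -> x ord0 j \is a Num.int].
Arguments mixed_integer_space : clear implicits.

(* What the comparison of two minimization programs in x : T depends on: the
   optimal value, and the points x at which it is attained (for some choice of
   the other variables or indices, if there are any). *)
Record min_program (R : realType) (T : Type) := MinProgram {
  optimal_value : \bar R;
  optimal_points : set T }.

(* inf_(x in X) F x *)
Definition simple_program (R : realType) (T : Type)
    (X : set T) (F : T -> \bar R) : min_program R T :=
  let v := ereal_inf [set F x | x in X] in
  MinProgram v [set x | X x /\ F x = v].

(* inf_(k : K) (c k + inf_(x in X) F k x) *)
Definition indexed_program (R : realType) (T K : Type)
    (X : set T) (c : K -> \bar R) (F : K -> T -> \bar R) : min_program R T :=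
  let v :=
    ereal_inf [set (c k + ereal_inf [set F k x | x in X])%E | k in setT] in
  MinProgram v [set x | X x /\ exists k : K, (c k + F k x)%E = v].

Definition equivalent_programs (R : realType) (T : Type)
    (P Q : min_program R T) : Prop :=
  optimal_value P = optimal_value Q /\
  (optimal_value P \is a fin_num ->
   forall x : T, optimal_points P x <-> optimal_points Q x).

Definition gamma_objective (R : realType) (T : Type) (m : nat) (Gamma : nat)
    (U : 'I_m -> set R) (ubar : 'I_m -> R) (f : 'I_m -> T -> R -> R) (x : T) :
    \bar R :=
  ereal_sup [set (\sum_(i in S) ereal_sup [set (f i x u)%:E | u in U i] +
                  \sum_(i in ~: S) (f i x (ubar i))%:E)%E |
             S in [set S : {set 'I_m} | (#|S| <= Gamma)%N]].

Definition gamma_counterpart (R : realType) (T : Type) (m : nat)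
    (X : set T) (Gamma : nat) (U : 'I_m -> set R) (ubar : 'I_m -> R)
    (f : 'I_m -> T -> R -> R) : min_program R T :=
  simple_program X (gamma_objective Gamma U ubar f).

(* [m] is 'I_m and [m]_0 is 'I_m.+1: here ord0 is the extra index 0, with value
   0, and lift ord0 j stands for the element j of [m]. *)
Definition extend0 (R : realType) (m : nat) (du : 'I_m -> R) (k : 'I_m.+1) : R :=
  if unlift ord0 k is Some j then du j else 0.

(* Main.v *)
Require Import Defs.
From HB Require Import structures.
From mathcomp Require Import all_boot all_order all_algebra.
From mathcomp Require Import all_classical all_reals all_analysis.
From mathcomp Require Import lra.
Set Implicit Arguments.
Unset Strict Implicit.
Unset Printing Implicit Defensive.
Import Order.TTheory GRing.Theory Num.Theory.
Local Open Scope classical_set_scope.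
Local Open Scope ring_scope.

(** Fix a feasible [x].  Since [f i x] is linear with slope [l i x >= 0], each
    inner supremum sits at the right end of its interval, and the objective of
    the Gamma-counterpart is the nominal cost [\sum_i ubar i * l i x] plus the
    maximum of [\sum_(i in S) du i * l i x] over the sets [S] of at most Gamma
    indices ([gamma_objectiveE]).

    That maximum equals the minimum over thresholds [t >= 0] of the Lagrangian
    dual function, where [t] prices the cardinality constraint on [S]:
    [Gamma * t + \sum_j max(0, du j - t) * l j x].  Weak duality
    ([threshold_upper_bound]) holds for every [t].  It is tight at some
    threshold among [0] and the [du k] ([threshold_attained]): because [l] takes
    the values 0 and 1, an optimal [S] consists of the Gamma indices of largest
    [du] in the support of [l] (all of the support if it is smaller), and the
    least [du] over [S] (respectively 0) is such a threshold.  The candidate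
    thresholds do not depend on [x].

    So at each feasible [x] the robust objective is the minimum over [k] of the
    indexed objectives, and exchanging the infima over [x] and [k] preserves
    the value and the points attaining it ([equivalent_programs_min]). *)

(** * Pointwise minima and indexed programs *)

(** The two infima commute, and the minimum over [k] is attained at each [x],
    so an optimal [x] comes with an optimal [k].  Finiteness of [c k] is what
    lets it move in and out of an infimum that may be infinite. *)
Lemma equivalent_programs_min (R : realType) (T K : Type) (X : set T)
    (F : T -> \bar R) (c : K -> \bar R) (G : K -> T -> \bar R) :
  (forall k, c k \is a fin_num) ->
  (forall x k, X x -> (F x <= c k + G k x)%E) ->
  (forall x, X x -> exists k, (c k + G k x <= F x)%E) ->
  equivalent_programs (simple_program X F) (indexed_program X c G).
Proof.
move=> c_fin F_le F_ge.
have value_eq : ereal_inf [set F x | x in X] =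
    ereal_inf [set (c k + ereal_inf [set G k x | x in X])%E | k in setT].
  apply/eqP; rewrite eq_le; apply/andP; split.
    apply: le_ereal_inf_tmp => _ [k _ <-].
    rewrite -leeBlDl//; apply: le_ereal_inf_tmp => _ [x Xx <-].
    rewrite leeBlDl//; apply: le_trans (F_le x k Xx).
    by apply: ereal_inf_lbound; exists x.
  apply: le_ereal_inf_tmp => _ [x Xx <-].
  have [k Fk] := F_ge x Xx; apply: le_trans Fk.
  apply: (@le_trans _ _ (c k + ereal_inf [set G k x | x in X])%E).
    by apply: ereal_inf_lbound; exists k.
  by apply: leeD2l; apply: ereal_inf_lbound; exists x.
split=> // _ x; rewrite /= -value_eq; split=> -[Xx].
  move=> <-; split=> //; have [k Fk] := F_ge x Xx; exists k.
  by apply/eqP; rewrite eq_le Fk F_le.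
case=> k kv; split=> //; apply/eqP; rewrite eq_le -{1}kv F_le//=.
by apply: ereal_inf_lbound; exists x.
Qed.

(** * Worst-case deviations *)

(** A nonnegative slope puts the worst case at the right end of the interval. *)
Lemma sup_linear_itv (R : realType) (a d s : R) (g : R -> R) :
  0 <= d -> 0 <= s -> (forall u, `[a, a + d]%classic u -> g u = u * s) ->
  ereal_sup [set (g u)%:E | u in `[a, a + d]] = ((a + d) * s)%:E.
Proof.
move=> d0 s0 gE; have ad : `[a, a + d]%classic (a + d).
  by rewrite /= in_itv /= lexx lerDl d0.
apply/eqP; rewrite eq_le; apply/andP; split.
  apply: ge_ereal_sup => _ [u uI <-]; rewrite gE // lee_fin.
  by move: uI; rewrite /= in_itv /= => /andP[_ ua]; apply: ler_wpM2r.
by apply: ereal_sup_ubound; exists (a + d); rewrite // gE.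
Qed.

Lemma gamma_objectiveE (R : realType) (T : Type) (m Gamma : nat)
    (U : 'I_m -> set R) (ubar du : 'I_m -> R) (f : 'I_m -> T -> R -> R)
    (l : 'I_m -> T -> R) (x : T) :
  (forall i, U i = `[ubar i, ubar i + du i]%classic) ->
  (forall i, 0 <= du i) -> (forall i, 0 <= l i x) ->
  (forall i u, U i u -> f i x u = u * l i x) ->
  gamma_objective Gamma U ubar f x =
  ereal_sup [set (\sum_i ubar i * l i x + \sum_(i in S) du i * l i x)%:E |
             S in [set S : {set 'I_m} | (#|S| <= Gamma)%N]].
Proof.
move=> UE du0 l0 fE; rewrite /gamma_objective; congr ereal_sup.
apply: eq_imagel => S _ /=.
have supE i : ereal_sup [set (f i x u)%:E | u in U i] =
    ((ubar i + du i) * l i x)%:E.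
  by rewrite UE; apply: sup_linear_itv => // u; rewrite -UE; apply: fE.
have nomE i : f i x (ubar i) = ubar i * l i x.
  by apply: fE; rewrite UE /= in_itv /= lexx lerDl du0.
under eq_bigr do rewrite supE.
under [X in (_ + X)%E]eq_bigr do rewrite nomE.
rewrite !sumEFin -EFinD; congr EFin.
under [X in X + _ = _]eq_bigr do rewrite mulrDl.
rewrite big_split /= addrAC; congr (_ + _).
rewrite [RHS](bigID [in S]) /=; congr (_ + _).
by apply: eq_bigl => i; rewrite inE.
Qed.

(** * Duality with thresholds *)

(** A greedy choice: repeatedly add a remaining element of maximal weight. *)
Lemma exists_heaviest_subset (R : realType) (I : finType) (w : I -> R)
    (A : {set I}) (g : nat) : (g <= #|A|)%N ->
  exists S : {set I}, [/\ S \subset A, #|S| = g &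
    forall i j, i \in S -> j \in A :\: S -> w j <= w i].
Proof.
elim: g => [_|g IHg gA].
  by exists finset.set0; split; rewrite ?finset.sub0set ?cards0 // => i j; rewrite inE.
have [S [SA Sg Smax]] := IHg (ltnW gA).
have /card_gt0P[a0 a0AS] : (0 < #|A :\: S|)%N.
  by rewrite cardsDS // Sg subn_gt0.
case: (arg_maxP w a0AS) => a aAS amax.
have /finset.setDP[aA aS] : a \in A :\: S by [].
exists (a |: S); split.
- by rewrite finset.subUset finset.sub1set aA.
- by rewrite cardsU1 aS Sg.
move=> i j + /finset.setDP[jA]; rewrite !inE negb_or => iaS /andP[_ jS].
have jAS : j \in A :\: S by rewrite !inE jS.
by case/orP: iaS => [/eqP->|iS]; [apply: amax | apply: Smax].
Qed.

(** Weak duality: each of the at most [g] terms satisfies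
    [d i * s i <= t + max 0 (d i - t) * s i], since [t * s i <= t]. *)
Lemma threshold_upper_bound (R : realType) (I : finType) (d s : I -> R)
    (t : R) (g : nat) (S : {set I}) :
  0 <= t -> (forall i, 0 <= s i <= 1) -> (#|S| <= g)%N ->
  \sum_(i in S) d i * s i <= g%:R * t + \sum_i Num.max 0 (d i - t) * s i.
Proof.
move=> t0 s01 Sg.
apply: (@le_trans _ _ (\sum_(i in S) (t + Num.max 0 (d i - t) * s i))).
  apply: ler_sum => i _; have /andP[s0 s1] := s01 i.
  have : t * s i <= t by rewrite ler_piMr.
  have : (d i - t) * s i <= Num.max 0 (d i - t) * s i.
    by rewrite ler_wpM2r // le_max lexx orbT.
  rewrite mulrBl; lra.
rewrite big_split /= sumr_const -[t *+ _]mulr_natl lerD //.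
  by rewrite ler_wpM2r // ler_nat.
rewrite [leRHS](bigID [in S]) /= lerDl; apply: sumr_ge0 => i _.
by rewrite mulr_ge0 ?le_max ?lexx //; case/andP: (s01 i).
Qed.

(** Strong duality for 0-1 coefficients.  If the support of [s] has at most [g]
    elements, the constraint is slack and the threshold 0 works.  Otherwise let
    [S] be the [g] heaviest elements of the support and the threshold the least
    weight in [S]: on the support, the positive parts vanish outside [S], and
    inside [S] they are plain differences. *)
Lemma threshold_attained (R : realType) (m : nat) (d s : 'I_m -> R) (g : nat) :
  (0 < g)%N -> (forall i, 0 <= d i) -> (forall i, s i = 0 \/ s i = 1) ->
  exists (k : 'I_m.+1) (S : {set 'I_m}), (#|S| <= g)%N /\
    g%:R * extend0 d k + \sum_i Num.max 0 (d i - extend0 d k) * s i =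
    \sum_(i in S) d i * s i.
Proof.
move=> g0 d0 s01; pose L : {set 'I_m} := [set i | s i == 1]%SET.
have s1 i : i \in L -> s i = 1 by rewrite inE => /eqP.
have s0 i : i \notin L -> s i = 0.
  by rewrite inE => /eqP sN1; case: (s01 i).
have [Lg|gL] := leqP #|L| g.
  exists ord0, L; split=> //; rewrite /extend0 unlift_none mulr0 add0r.
  rewrite [LHS](bigID [in L]) /= [X in _ + X]big1 ?addr0; last first.
    by move=> i /s0 ->; rewrite mulr0.
  by apply: eq_bigr => i _; rewrite subr0 max_r.
have [S [SL Sg Smax]] := exists_heaviest_subset d (ltnW gL).
have /card_gt0P[i0 i0S] : (0 < #|S|)%N by rewrite Sg.
case: (arg_minP d i0S) => k kS kmin.
exists (lift ord0 k), S; rewrite Sg; split=> //; rewrite /extend0 liftK.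
rewrite (bigID [in S]) /= [X in _ + (_ + X)]big1 ?addr0; last first.
  move=> i iS; have [iL|/s0->] := boolP (i \in L); last by rewrite mulr0.
  have dik : d i <= d k by apply: Smax => //; rewrite inE iS.
  by rewrite max_l ?mul0r // subr_le0.
rewrite -Sg mulr_natl -sumr_const -big_split /=; apply: eq_bigr => i iS.
rewrite (s1 i (fintype.subsetP SL i iS)) !mulr1 max_r ?subr_ge0 ?kmin //.
by rewrite addrC subrK.
Qed.

Lemma extend0_ge0 (R : realType) (m : nat) (d : 'I_m -> R) (k : 'I_m.+1) :
  (forall i, 0 <= d i) -> 0 <= extend0 d k.
Proof. by rewrite /extend0; case: unlift. Qed.

(** * The Gamma-counterpart *)

Theorem theorem3p14 (R : realType) (n m p : nat)
    (n_ge1 : (1 <= n)%N) (m_ge1 : (1 <= m)%N) (p_le_n : (p <= n)%N)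
    (X : set 'rV[R]_n) (X_mixed : X `<=` mixed_integer_space R p n)
    (U : 'I_m -> set R) (ubar du : 'I_m -> R)
    (U_itv : forall i, U i = `[ubar i, ubar i + du i]%classic)
    (U_pos : forall i, U i `<=` [set u | 0 < u])
    (du_gt0 : forall i, 0 < du i)
    (f : 'I_m -> 'rV[R]_n -> R -> R) (l : 'I_m -> 'rV[R]_n -> R)
    (l01 : forall i x, X x -> l i x = 0 \/ l i x = 1)
    (f_lin : forall i x u, X x -> U i u -> f i x u = u * l i x)
    (Gamma : nat) (Gamma_bounds : (1 <= Gamma <= m)%N) :
  equivalent_programs
    (gamma_counterpart X Gamma U ubar f)
    (indexed_program X
      (fun k : 'I_m.+1 => (Gamma%:R * extend0 du k)%:E)
      (fun (k : 'I_m.+1) (x : 'rV[R]_n) =>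
        (\sum_(i < m) ubar i * l i x +
         \sum_(j < m) Num.max 0 (du j - extend0 du k) * l j x)%:E)).
Proof.
have du_ge0 i : 0 <= du i by apply: ltW.
have l_itv x i : X x -> 0 <= l i x <= 1.
  by move=> Xx; case: (l01 i x Xx) => ->; rewrite ?lexx ?ler01.
have objE x : X x -> gamma_objective Gamma U ubar f x =
    ereal_sup [set (\sum_i ubar i * l i x + \sum_(i in S) du i * l i x)%:E |
               S in [set S : {set 'I_m} | (#|S| <= Gamma)%N]].
  move=> Xx; apply: gamma_objectiveE => // [i|i u Uu]; last exact: f_lin.
  by case/andP: (l_itv x i Xx).
apply: equivalent_programs_min => // [x k Xx|x Xx]; rewrite objE //.
  apply: ge_ereal_sup => _ [S /= Sg <-].
  rewrite -EFinD lee_fin addrCA lerD2l.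
  by apply: threshold_upper_bound => // [|i]; [apply: extend0_ge0 | apply: l_itv].
case/andP: Gamma_bounds => Gamma_gt0 _.
have [k [S [Sg dualE]]] :=
  threshold_attained Gamma_gt0 du_ge0 (fun i => l01 i x Xx).
exists k; rewrite -EFinD addrCA dualE.
by apply: ereal_sup_ubound; exists S.
Qed.
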